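(* Let $n\ge 4$ be an integer and let $G$ be a simple graph. Then $G$ is isomorphic to the open wheel $W_n'$ if and only if all of the following hold: $$[x]\,da(G;x,y) = 2y^{n-1} + (n-2)y^{n-2}+ y,$$ $$[x^{n}]\,da(G;x,y) = 3y^{n+1}+(n-2)y^{n+2},$$ $$[x^{n+1}]\,da(G;x,y) = y^{n+3}.$$
   Context: All graphs are finite, simple and have at least one vertex. For a graph $G$, $S\subseteq V(G)$ and $u\in V(G)$, let $\bar S=V(G)\setminus S$, let $\delta_S(u)=|\{v\in S:\{u,v\}\in E(G)\}|$, and let $G[S]$ be the subgraph induced by $S$. The defensive alliance polynomial of $G$ is $$da(G;x,y)=\sum_{S} x^{|S|}\,y^{f_y(S)},\qquad f_y(S)=\min_{u\in S}\bigl(\delta_S(u)-\delta_{\bar S}(u)+|V(G)|\bigr),$$ where the sum runs over all non-empty $S\subseteq V(G)$ such that $G[S]$ is connected (single-vertex graphs are connected). $[x^k]\,da(G;x,y)$ denotes the coefficient of $x^k$ in $da(G;x,y)$, which is a polynomial in $y$. The open wheel (fan) $W_n'$ is the graph join $P_n+K_1$, i.e. the path $P_n$ on $n$ vertices together with one extra vertex adjacent to all vertices of the path (so it has $n+1$ vertices). *)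

(* Defs.v *)
From HB Require Import structures.
From mathcomp Require Import all_boot all_order all_algebra.
Set Implicit Arguments.
Unset Strict Implicit.
Unset Printing Implicit Defensive.
Import GRing.Theory.
Local Open Scope ring_scope.

(* The vertex set may be empty here: non-emptiness is a separate hypothesis. *)
Record sgraph := SGraph {
  vertex :> finType;
  edge : rel vertex;
  edge_sym : symmetric edge;
  edge_irrefl : irreflexive edge }.

Definition isomorphic (G H : sgraph) : Prop :=
  exists2 f : G -> H, bijective f & forall u v, edge (f u) (f v) = edge u v.

Section Induced.
Variables (G : sgraph) (S : {set G}).

Definition induced_rel : rel {u : G | u \in S} :=
  fun u v => edge (val u) (val v).

Lemma induced_sym : symmetric induced_rel.
Proof. by move=> u v; exact: edge_sym. Qed.

Lemma induced_irrefl : irreflexive induced_rel.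
Proof. by move=> u; exact: edge_irrefl. Qed.

Definition induced : sgraph := SGraph induced_sym induced_irrefl.

End Induced.

Definition connected (G : sgraph) : bool :=
  [forall u : G, forall v : G, connect (@edge G) u v].

Section Alliance.
Variable G : sgraph.

Definition deg_in (S : {set G}) (u : G) : nat := #|[set v in S | edge u v]|.

(* Since deg_in (~: S) u <= #|G|, the truncated subtraction is exact once #|G|
   has been added first.  The values being minimised are at most 2 * #|G|, so
   the default value of the iterated minimum only matters when S is empty. *)
Definition f_y (S : {set G}) : nat :=
  \big[minn/(2 * #|G|)%N]_(u in S) (deg_in S u + #|G| - deg_in (~: S) u)%N.

(* The outer variable is x and the inner one is y. *)
Definition da : {poly {poly int}} :=
  \sum_(S : {set G} | (S != set0) && connected (induced S))
     ('X^(f_y S))%:P * 'X^#|S|.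

End Alliance.

Section Path.
Variable n : nat.

Definition path_rel : rel 'I_n :=
  fun i j => (i.+1 == j :> nat) || (j.+1 == i :> nat).

Lemma path_sym : symmetric path_rel.
Proof. by move=> i j; rewrite /path_rel orbC. Qed.

Lemma path_irrefl : irreflexive path_rel.
Proof. by move=> i; rewrite /path_rel orbb gtn_eqF. Qed.

Definition path_graph : sgraph := SGraph path_sym path_irrefl.

Definition complete_rel : rel 'I_n := fun i j => i != j.

Lemma complete_sym : symmetric complete_rel.
Proof. by move=> i j; rewrite /complete_rel eq_sym. Qed.

Lemma complete_irrefl : irreflexive complete_rel.
Proof. by move=> i; rewrite /complete_rel eqxx. Qed.

Definition complete_graph : sgraph := SGraph complete_sym complete_irrefl.

End Path.

Section Join.
Variables G H : sgraph.

Definition join_rel : rel (G + H)%type := fun a b =>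
  match a, b with
  | inl u, inl v => edge u v
  | inr u, inr v => edge u v
  | _, _ => true
  end.

Lemma join_sym : symmetric join_rel.
Proof. by move=> [u|u] [v|v] //=; exact: edge_sym. Qed.

Lemma join_irrefl : irreflexive join_rel.
Proof. by move=> [u|u] /=; exact: edge_irrefl. Qed.

Definition graph_join : sgraph := SGraph join_sym join_irrefl.

End Join.

Definition open_wheel (n : nat) : sgraph :=
  graph_join (path_graph n) (complete_graph 1).

(* Main.v *)
Require Import Defs.
From mathcomp Require Import all_boot all_order all_algebra.
From mathcomp Require Import zify ring.
Import GRing.Theory.
Local Open Scope ring_scope.

(* The coefficient of x records the degree sequence, hence also the order n + 1:
   one universal vertex w, two vertices of degree 2, all others of degree 3.
   Evaluated at y = 1, the coefficient of x^n counts the vertices whose deletion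
   leaves a connected graph; it equals n + 1, so G - w is connected.  There every
   degree is at most 2 and some vertex a has degree 1, so the simple path grown
   from a exhausts G - w without chords. *)

(** * Connected sets, minima, and the coefficients given by single vertices and their complements *)

Section Coefficients.
Variable G : sgraph.
Implicit Types (S A : {set G}) (u v : G).

(** Connectivity is phrased by cuts so that later proofs only close sets under edges of [G] and
    never build paths in the subtype. For the converse, the component of [u] serves as [A]. *)
Lemma inducedP S :
  reflect (forall A, A \subset S -> A != set0 ->
             (forall u v, u \in A -> v \in S -> edge u v -> v \in A) -> S \subset A)
          (connected (induced S)).
Proof.
apply: (iffP idP) => [conS A sAS /set0Pn[u uA] clA | cutS].
  apply/subsetP => v vS.
  have uS := subsetP sAS u uA.
  move/forallP/(_ (exist _ u uS))/forallP/(_ (exist _ v vS)): conS.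
  have clA' : closed (@edge (induced S)) [pred x | val x \in A].
    apply: intro_closed => [|[x xS] [y yS] exy xA /=].
      exact/sym_connect_sym/edge_sym.
    exact: clA xA yS exy.
  by move/(closed_connect clA'); rewrite !inE /= uA => <-.
apply/forallP => u; apply/forallP => v.
suff /subsetP/(_ _ (valP v)) : S \subset val @: [set x | connect (@edge (induced S)) u x].
  by rewrite mem_imset ?inE //; exact: val_inj.
apply: cutS.
- by apply/subsetP => _ /imsetP[x _ ->]; exact: valP.
- by apply/set0Pn; exists (val u); rewrite imset_f // inE connect0.
move=> _ y /imsetP[x ux ->] yS exy; apply/imsetP; exists (exist _ y yS) => //.
by move: ux; rewrite !inE => /connect_trans; apply; exact: connect1.
Qed.

Lemma deg_inE S u : deg_in S u = (\sum_(v in S) edge u v)%N.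
Proof.
rewrite /deg_in -sum1_card big_mkcond [RHS]big_mkcond /=.
by apply: eq_bigr => v _; rewrite inE; case: (v \in S); case: (edge u v).
Qed.

Lemma deg_in_max S u : (deg_in S u <= #|G|)%N.
Proof. exact: max_card. Qed.

Lemma size_nbr_leq (s : seq G) u :
  uniq s -> all (edge u) s -> (size s <= deg_in setT u)%N.
Proof.
move=> us /allP es; rewrite /deg_in cardE; apply: uniq_leq_size => // v /es euv.
by rewrite mem_enum !inE.
Qed.


Lemma leq_f_yP (m : nat) S :
  reflect ((m <= 2 * #|G|)%N /\
           forall u, u \in S -> m <= deg_in S u + #|G| - deg_in (~: S) u)%N
          (m <= f_y S)%N.
Proof. exact: (@Order.TotalTheory.bigmin_geP _ nat). Qed.

Lemma f_y_eq S (m : nat) :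
  (forall u, u \in S -> m <= deg_in S u + #|G| - deg_in (~: S) u)%N ->
  (exists2 u, u \in S & deg_in S u + #|G| - deg_in (~: S) u = m)%N ->
  f_y S = m.
Proof.
move=> lb [u uS um]; apply/eqP; rewrite eqn_leq; apply/andP; split.
  by have [_ /(_ u uS)] := leq_f_yP _ _ (leqnn (f_y S)); rewrite um.
(* The default [2 * #|G|] is never below a term, because [deg_in S u] is at most [#|G|]. *)
by apply/leq_f_yP; split=> //; have := deg_in_max S u; lia.
Qed.

Lemma f_y1 u : f_y [set u] = (#|G| - deg_in setT u)%N.
Proof.
have val1 : (deg_in [set u] u + #|G| - deg_in (~: [set u]) u = #|G| - deg_in setT u)%N.
  rewrite [deg_in setT u]deg_inE (bigD1 u) //= !deg_inE big_set1 edge_irrefl !add0n.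
  by congr (_ - _)%N; apply: eq_bigl => v; rewrite !inE.
apply: f_y_eq => [v /set1P->|]; first by rewrite val1.
by exists u; rewrite ?set11.
Qed.

(** Deleting [v] moves at most one neighbour of [u] from inside to outside, and such a move changes
    the difference by two. *)
Lemma deg_inC1 u v :
  (deg_in [set~ v] u + #|G| - deg_in (~: [set~ v]) u
   = deg_in setT u + #|G| - 2 * edge u v)%N.
Proof.
have -> : (deg_in setT u = edge u v + deg_in [set~ v] u)%N.
  rewrite !deg_inE (bigD1 v) //=.
  by congr (_ + _)%N; apply: eq_bigl => w; rewrite !inE.
rewrite setCK [deg_in [set v] u]deg_inE big_set1; lia.
Qed.

Lemma coef_daE (k : nat) :
  (da G)`_k = \sum_(S : {set G} | #|S| == k)
    (if (S != set0) && connected (induced S) then 'X^(f_y S) else 0).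
Proof.
rewrite /da coef_sum big_mkcond [RHS]big_mkcond /=; apply: eq_bigr => S _.
rewrite coefCM coefXn [k == _]eq_sym.
by case: (_ && _); case: (_ == k); rewrite ?mulr1 ?mulr0.
Qed.

Lemma connected1 u : connected (induced [set u]).
Proof.
apply/inducedP => A; rewrite subset1 => /orP[/eqP-> //|/eqP->].
by rewrite eqxx.
Qed.

Lemma coef_da1 : (da G)`_1 = \sum_(u : G) 'X^(#|G| - deg_in setT u).
Proof.
rewrite coef_daE (eq_bigl (fun S => S \in set1 @: [set: G])) => [|S]; last first.
  by apply/cards1P/imsetP => [[u ->]|[u _ ->]]; exists u.
rewrite big_imset => [|u v _ _]; last exact: set1_inj.
rewrite big_mkcond; apply: eq_bigr => u _.
by rewrite inE connected1 -card_gt0 cards1 f_y1.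
Qed.

(** The sets of size one below the order are the complements of single vertices; the form [n.+2] of
    the order makes them non-empty. *)
Lemma coef_da_predn (n : nat) : #|G| = n.+2 ->
  (da G)`_n.+1 =
  \sum_(v : G) (if connected (induced [set~ v]) then 'X^(f_y [set~ v]) else 0).
Proof.
move=> cardG; rewrite coef_daE (eq_bigl (fun S => S \in (fun u => [set~ u]) @: [set: G])).
  rewrite big_imset => [|u v _ _ /setC_inj]; last exact: set1_inj.
  rewrite big_mkcond; apply: eq_bigr => u _.
  by rewrite inE -card_gt0 cardsC1 cardG.
move=> S; have := cardsC S; rewrite cardG => cardSC.
apply/idP/imsetP => [/eqP cardS|[u _ ->]]; last by rewrite cardsC1 cardG.
have /cards1P[u Cu] : #|~: S| == 1%N by lia.
by exists u; rewrite // -Cu setCK.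
Qed.

End Coefficients.

(** * Invariance under isomorphism *)

Section Isomorphism.
Variables (G H : sgraph) (f : G -> H).
Hypotheses (bij_f : bijective f) (edge_f : forall u v, edge (f u) (f v) = edge u v).
Let inj_f : injective f := bij_inj bij_f.

Lemma deg_in_iso (S : {set G}) u : deg_in (f @: S) (f u) = deg_in S u.
Proof.
by rewrite !deg_inE big_imset => [|x y _ _ /inj_f//]; apply: eq_bigr => v _; rewrite edge_f.
Qed.

Lemma imset_isoC (S : {set G}) : ~: (f @: S) = f @: ~: S.
Proof.
apply/setP => v; have [g _ gK] := bij_f.
by rewrite -(gK v) inE !mem_imset // inE.
Qed.

Lemma f_y_iso (S : {set G}) : f_y (f @: S) = f_y S.
Proof.
have cardGH := bij_eq_card bij_f.
apply/eqP; rewrite eqn_leq; apply/andP; split; apply/leq_f_yP.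
  have [le2 leS] := leq_f_yP _ _ _ (leqnn (f_y (f @: S))).
  split=> [|u uS]; first by rewrite cardGH.
  by have := leS _ (imset_f f uS); rewrite imset_isoC !deg_in_iso cardGH.
have [le2 leS] := leq_f_yP _ _ _ (leqnn (f_y S)).
split=> [|_ /imsetP[u uS ->]]; first by rewrite -cardGH.
by rewrite imset_isoC !deg_in_iso -cardGH; exact: leS.
Qed.

Lemma connected_iso (S : {set G}) :
  connected (induced S) -> connected (induced (f @: S)).
Proof.
move/inducedP => cutS; apply/inducedP => A sAS /set0Pn[x xA] clA.
rewrite sub_imset_pre; apply: cutS.
- apply/subsetP => u; rewrite inE => /(subsetP sAS).
  by rewrite mem_imset.
- have /imsetP[u _ xu] := subsetP sAS x xA.
  by apply/set0Pn; exists u; rewrite inE -xu.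
move=> u v; rewrite !inE => fuA vS euv.
by apply: clA fuA _ _; rewrite ?imset_f ?edge_f.
Qed.

End Isomorphism.

Lemma isomorphic_sym (G H : sgraph) : isomorphic G H -> isomorphic H G.
Proof.
move=> [f [g fK gK] ef]; exists g; first by exists f.
by move=> u v; rewrite -ef !gK.
Qed.

(** Taking images under [f] is a bijection on vertex sets that preserves size, [f_y] and
    connectivity, so the sum can be reindexed. Connectivity is reflected because the inverse [g]
    preserves it too. *)
Lemma isomorphic_da (G H : sgraph) : isomorphic G H -> da G = da H.
Proof.
move=> isoGH; have [f bij_f ef] := isoGH; have [g fK gK] := bij_f.
have bij_g : bijective g by exists f.
have eg u v : edge (g u) (g v) = edge u v by rewrite -ef !gK.
have imfK : cancel (fun S : {set G} => f @: S) (fun T : {set H} => g @: T).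
  by move=> S; rewrite -imset_comp (eq_imset _ fK) imset_id.
have imgK : cancel (fun T : {set H} => g @: T) (fun S : {set G} => f @: S).
  by move=> T; rewrite -imset_comp (eq_imset _ gK) imset_id.
rewrite /da [RHS](reindex (fun S : {set G} => f @: S)) /=; last first.
  by exists (fun T : {set H} => g @: T) => S _.
apply: eq_big => [S|S _]; last first.
  by rewrite f_y_iso // card_imset //; exact: bij_inj.
rewrite imset_eq0; congr (_ && _); apply/idP/idP; first exact: connected_iso.
by move/(connected_iso _ _ _ bij_g eg); rewrite imfK.
Qed.

(** * Degrees and coefficients of the open wheel *)

Lemma sum_nat_eq (n k : nat) : (\sum_(j < n) (k == j) = (k < n))%N.
Proof.
case: ltnP => [kn|nk]; last first.
  by apply: big1 => j _; rewrite gtn_eqF //; exact: leq_trans nk.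
rewrite (bigD1 (Ordinal kn)) //= eqxx big1 // => j.
by rewrite -val_eqE /= eq_sym => /negPf->.
Qed.

Section OpenWheel.
Variable n : nat.
Let W := open_wheel n.
Let rim (i : 'I_n) : W := inl i.
Let hub : W := inr ord0.

Lemma open_wheel_ind (P : W -> Prop) :
  P hub -> (forall i, P (rim i)) -> forall u, P u.
Proof. by move=> Ph Pr [i|j]; [exact: Pr | rewrite (ord1 j)]. Qed.

Lemma card_open_wheel : #|W| = n.+1.
Proof. by rewrite card_sum !card_ord addn1. Qed.

Lemma big_open_wheel (R : nmodType) (F : W -> R) :
  \sum_u F u = \sum_(i < n) F (rim i) + F hub.
Proof. by rewrite big_sumType /= big_ord1. Qed.

Lemma deg_hub : deg_in [set: W] hub = n.
Proof.
rewrite deg_inE big_mkcond big_sumType /= big_ord1 inE /= addn0.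
rewrite (eq_bigr (fun=> 1%N)) => [|i _]; last by rewrite inE.
by rewrite sum_nat_const card_ord muln1.
Qed.

(** The summands count the hub, the predecessor and the successor on the path. No vertex is both
    predecessor and successor, so the disjunction in [path_rel] is a sum of indicators, and
    [sum_nat_eq] evaluates each of the two sums. *)
Lemma deg_rim (i : 'I_n) : deg_in [set: W] (rim i) = (1 + (0 < i) + (i.+1 < n))%N.
Proof.
rewrite deg_inE big_mkcond big_sumType /= big_ord1 inE /= addn1 add1n addSn.
congr _.+1; rewrite -(sum_nat_eq n i.+1).
have -> : (0 < i)%N = (\sum_(j < n) (j.+1 == i))%N :> nat.
  case: i => -[|k] kn /=; first by rewrite big1.
  rewrite (eq_bigr (fun j : 'I_n => (k == j) : nat)) => [|j _]; last by rewrite eqSS eq_sym.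
  by rewrite sum_nat_eq ltnW.
rewrite -big_split; apply: eq_bigr => j _; rewrite inE /edge /= /path_rel.
by case: eqP; case: eqP => //; lia.
Qed.

Lemma connected_hubC : connected (induced [set~ hub]).
Proof.
apply/inducedP => A sA /set0Pn[u uA] clA.
have {u uA} [i iA] : exists i, rim i \in A.
  move: u uA; apply: open_wheel_ind => [hA|i]; last by exists i.
  by have := subsetP sA hub hA; rewrite !inE eqxx.
have step (j k : 'I_n) : path_rel j k -> rim j \in A -> rim k \in A.
  by move=> ejk jA; apply: clA jA _ _; rewrite ?inE.
(* Starting from one rim vertex of [A], closure spreads along the path in both directions, by
   induction on the distance [d]. *)
have up d (j : 'I_n) : (j = i + d :> nat)%N -> rim j \in A.
  elim: d j => [|d IH] j ji; first by rewrite (_ : j = i) //; apply: val_inj => /=; lia.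
  have dn : (i + d < n)%N by have := ltn_ord j; lia.
  by apply: step (IH (Ordinal dn) erefl); apply/orP; left; rewrite /= ji addnS.
have down d (j : 'I_n) : (j + d = i :> nat)%N -> rim j \in A.
  elim: d j => [|d IH] j ji; first by rewrite (_ : j = i) //; apply: val_inj => /=; lia.
  have dn : (j.+1 < n)%N by have := ltn_ord i; lia.
  apply: (step (Ordinal dn)); first by apply/orP; right.
  by apply: IH => /=; lia.
apply/subsetP; apply: open_wheel_ind => [|j _]; first by rewrite !inE eqxx.
by case: (leqP i j) => ij; [apply: (up (j - i)%N)|apply: (down (i - j)%N)]; lia.
Qed.

(** The hub survives the deletion and is adjacent to every remaining vertex. *)
Lemma connected_rimC (i : 'I_n) : connected (induced [set~ rim i]).
Proof.
apply/inducedP => A sA /set0Pn[u uA] clA.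
have hA : hub \in A.
  move: u uA; apply: open_wheel_ind => // j jA.
  by apply: clA jA _ _; rewrite ?inE.
apply/subsetP; apply: open_wheel_ind => // j jS.
by apply: clA hA jS _.
Qed.

Hypothesis n4 : (4 <= n)%N.

(** Every rim vertex loses the hub. The ends of the path, of degree 2, attain the minimum 2 + (n +
    1) - 2. *)
Lemma f_y_hubC : f_y [set~ hub] = n.+1.
Proof.
have n0 : (0 < n)%N by lia.
apply: f_y_eq => [|].
  apply: open_wheel_ind => [|i _]; first by rewrite !inE eqxx.
  by rewrite deg_inC1 deg_rim card_open_wheel /=; have := ltn_ord i; lia.
exists (rim (Ordinal n0)); first by rewrite !inE.
by rewrite deg_inC1 deg_rim card_open_wheel /=; lia.
Qed.

(* Deleting the neighbour of an end of the path leaves that end with the hub as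
   its only neighbour; every other deletion leaves a minimum of [n.+2]. *)
Lemma f_y_rimC (i : 'I_n) :
  f_y [set~ rim i] = (n.+2 - ((i == 1 :> nat) || (i.+2 == n)))%N.
Proof.
have valE (j : 'I_n) : (deg_in [set~ rim i] (rim j) + #|W|
    - deg_in (~: [set~ rim i]) (rim j)
    = 1 + (0 < j) + (j.+1 < n) + n.+1 - 2 * path_rel j i)%N.
  by rewrite deg_inC1 deg_rim card_open_wheel.
have hi := ltn_ord i.
apply: f_y_eq => [|].
  apply: open_wheel_ind => [_|j].
    by rewrite deg_inC1 deg_hub card_open_wheel /=; lia.
  rewrite !inE valE (inj_eq inl_inj) -val_eqE /path_rel /= => ji.
  by have := ltn_ord j; lia.
have wit k (kn : (k < n)%N) : k != i ->
    (1 + (0 < k) + (k.+1 < n) + n.+1 - 2 * ((k.+1 == i) || (i.+1 == k))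
      = n.+2 - ((i == 1 :> nat) || (i.+2 == n)))%N ->
    exists2 u, u \in [set~ rim i] & (deg_in [set~ rim i] u + #|W|
      - deg_in (~: [set~ rim i]) u = n.+2 - ((i == 1 :> nat) || (i.+2 == n)))%N.
  move=> ki kE; exists (rim (Ordinal kn)); last by rewrite valE.
  by rewrite !inE (inj_eq inl_inj) -val_eqE.
(* The minimum is attained at a path neighbour of the deleted vertex, taken to be an end of the path
   whenever one is adjacent. *)
have [i0|i0] := ltnP i 1; first by apply: (wit 1%N); lia.
have [i1|i1] := ltnP i 2; first by apply: (wit 0%N); lia.
have [i2|i2] := ltnP i.+2 n; first by apply: (wit i.-1); lia.
by have [i3|i3] := ltnP i.+1 n; [apply: (wit i.+1) | apply: (wit i.-1)]; lia.
Qed.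

Lemma da_open_wheel1 :
  (da W)`_1 = 2%:R * 'X^(n - 1) + (n - 2)%:R * 'X^(n - 2) + 'X.
Proof.
rewrite coef_da1 big_open_wheel deg_hub card_open_wheel subSnn expr1.
congr (_ + _); under eq_bigr => i _ do rewrite deg_rim.
case: n n4 => [|[|m]] // _.
(* The two ends of the path, of degree 2, are split off; all other rim vertices have degree 3. *)
rewrite big_ord_recl big_ord_recr /= ltnn.
rewrite (eq_bigr (fun=> 'X^m)) => [|i _]; last first.
  by congr ('X^_); rewrite /bump /=; have := ltn_ord i; lia.
rewrite sumr_const card_ord !mulr_natl.
rewrite [(m.+3 - _)%N](_ : _ = m.+1); last by lia.
by rewrite subn1 !subn2 addrCA -mulr2n addrC.
Qed.

Lemma da_open_wheeln :
  (da W)`_n = 3%:R * 'X^(n + 1) + (n - 2)%:R * 'X^(n + 2).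
Proof.
have nE : n = n.-1.+1 by lia.
rewrite [in LHS]nE coef_da_predn; last by rewrite -nE card_open_wheel.
rewrite big_open_wheel connected_hubC f_y_hubC.
under eq_bigr => i _ do rewrite connected_rimC f_y_rimC.
case: n n4 => [|[|[|[|m]]]] // _.
(* Splitting off two indices on each side, distinct since n is at least 4, isolates 1 and n - 2.
   Together with the hub they give the three terms of exponent n + 1. *)
rewrite 2!big_ord_recl 2!big_ord_recr /= !eqxx.
rewrite (eq_bigr (fun=> 'X^(m.+4.+2))) => [|i _]; last first.
  by congr ('X^_); rewrite /bump /=; have := ltn_ord i; lia.
rewrite sumr_const card_ord !mulr_natl !subn0 !subn1 /bump /= addn1 addn2 subn2 /=.
have -> : ((1 + (1 + m.+1)).+2 == m.+4)%N = false by lia.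
rewrite subn0.
ring.
Qed.

Lemma da_open_wheeln1 : (da W)`_(n + 1) = 'X^(n + 3).
Proof.
rewrite coef_daE (big_pred1 [set: W]) => [|S /=]; last first.
  by rewrite eqEcard subsetT cardsT eqn_leq addn1 -card_open_wheel max_card.
have -> : connected (induced [set: W]).
  apply/inducedP => A _ /set0Pn[u uA] clA.
  have hA : hub \in A.
    by move: u uA; apply: open_wheel_ind => // j jA; apply: clA jA _ _; rewrite ?inE.
  apply/subsetP; apply: open_wheel_ind => // j _.
  by apply: clA hA _ _; rewrite ?inE.
have -> : [set: W] != set0 by apply/set0Pn; exists hub.
(* Nothing lies outside the full set, so the minimum is the least degree, 2 at an end of the path,
   plus the order n + 1. *)
rewrite (@f_y_eq _ _ (n + 3)) //.
  apply: open_wheel_ind => [_|i _];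
    rewrite setCT ?deg_hub ?deg_rim card_open_wheel [deg_in set0 _]deg_inE big_set0;
    have := n4; [lia | have := ltn_ord i; lia].
have n0 : (0 < n)%N by lia.
exists (rim (Ordinal n0)); rewrite // deg_rim setCT card_open_wheel.
rewrite [deg_in set0 _]deg_inE big_set0 /=; lia.
Qed.

End OpenWheel.

(** * Recognizing the open wheel from its degrees and the connectivity of G - w *)

Section Recognition.
Variables (n : nat) (G : sgraph) (w a : G).
Hypotheses (cardG : #|G| = n.+1) (wU : forall u, u != w -> edge w u).
Hypotheses (aw : a != w) (deg_a : deg_in setT a = 2).
Hypotheses (deg_le3 : forall u, u != w -> (deg_in setT u <= 3)%N).
Hypothesis con_w : connected (induced [set~ w]).

(** Only consecutive edges are demanded; the absence of chords comes from the degree bounds, through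
    [rim_path_nbr]. *)
Definition rim_path (s : seq G) : Prop :=
  [/\ uniq s, w \notin s, nth a s 0 = a
    & forall i, (i.+1 < size s)%N -> edge (nth a s i) (nth a s i.+1)].

(** A vertex of the path other than its last has its degree used up by [w] and its neighbours on the
    path, so it has no further neighbour. *)
Lemma rim_path_nbr s i v : rim_path s -> (i.+1 < size s)%N -> v != w ->
  edge (nth a s i) v -> v = nth a s i.+1 \/ (0 < i)%N /\ v = nth a s i.-1.
Proof.
move=> [us ws s0 es] si vw eiv.
have nth_w j : (j < size s)%N -> nth a s j != w.
  by move=> sj; apply: contraNneq ws => <-; exact: mem_nth.
case: (eqVneq v (nth a s i.+1)) => [|v1]; first by left.
right; case: i si eiv v1 => [|i] si eiv v1.
  (* Otherwise [a], of degree 2, would have three distinct neighbours. *)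
  have := @size_nbr_leq _ [:: w; nth a s 1; v] a.
  rewrite deg_a /= !inE !negb_or ![w == _]eq_sym vw nth_w // eq_sym v1.
  rewrite -[X in edge X (nth a s 1)]s0 es // -[X in edge X v]s0 eiv.
  by rewrite edge_sym wU // => /(_ isT isT).
split=> //=; apply/eqP; apply: contraT => v2.
have si1 : (i.+1 < size s)%N := ltnW si.
have si0 : (i < size s)%N := ltnW si1.
have sw : nth a s i.+1 != w by exact: nth_w.
(* Otherwise an inner vertex, of degree at most 3, would have four distinct neighbours. *)
have := @size_nbr_leq _ [:: w; nth a s i; nth a s i.+2; v] (nth a s i.+1).
rewrite /= !inE !negb_or ![w == _]eq_sym vw !nth_w // nth_uniq //.
rewrite ![_ == v]eq_sym v1 v2 eiv es // edge_sym wU // edge_sym es //.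
move=> H; have := leq_trans (H _ isT) (deg_le3 _ sw).
by apply; rewrite ltn_eqF.
Qed.

(** While the path misses a vertex of G - w, connectivity provides an edge leaving it, and by
    [rim_path_nbr] that edge starts at the last vertex, where the path can be prolonged. *)
Lemma rim_path_exists m : (m < n)%N -> exists2 s, size s = m.+1 & rim_path s.
Proof.
elim: m => [|m IH] mn.
  by exists [:: a] => //; split=> //; rewrite inE eq_sym.
have [s sm [us ws s0 es]] := IH (ltnW mn).
case: (boolP [exists u in s, exists v, [&& v != w, edge u v & v \notin s]]).
  case/exists_inP => u us_ /existsP[v /and3P[vw euv vs]].
  exists (rcons s v); first by rewrite size_rcons sm.
  have rs : rim_path s by split.
  have iu : index u s = m.
    apply/eqP; rewrite eqn_leq -ltnS -sm index_mem us_ leqNgt /=.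
    apply/negP => im.
    have := rim_path_nbr s (index u s) v rs.
    rewrite sm ltnS nth_index // => /(_ im vw euv).
    by case=> [|[_]] vE; case/negP: vs; rewrite vE mem_nth // sm; lia.
  split.
  - by rewrite rcons_uniq vs.
  - by rewrite mem_rcons inE negb_or eq_sym vw.
  - by rewrite nth_rcons sm.
  move=> i; rewrite size_rcons sm ltnS => im; rewrite !nth_rcons sm im ltnS.
  case: ltngtP => [i_m||i_m]; [by apply: es; rewrite sm ltnS|by lia|].
  by rewrite i_m eqxx -iu nth_index.
move/exists_inPn => clS.
(* With no edge leaving it, [s] would contain all n vertices of G - w, but it has only [m.+1] of
   them. *)
have /subset_leq_card : [set~ w] \subset [set x in s].
  apply: (inducedP _ _ con_w).
  - by apply/subsetP => x; rewrite !inE; apply: contraTneq => ->.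
  - by apply/set0Pn; exists a; rewrite inE -s0 mem_nth // sm.
  move=> u v; rewrite !inE => us_ vw euv.
  by have /existsPn/(_ v) := clS u us_; rewrite vw euv /= negbK.
by rewrite cardsC1 cardG cardsE (card_uniqP us) sm /=; lia.
Qed.

Lemma recognize_open_wheel : (0 < n)%N -> isomorphic G (open_wheel n).
Proof.
move=> n0; have [s sn rs] : exists2 s, size s = n & rim_path s.
  by case: n n0 rim_path_exists => // m _ /(_ m (ltnSn m)).
have [us ws s0 es] := rs.
pose g (x : open_wheel n) : G := if x is inl i then nth a s i else w.
have inj_g : injective g.
  move=> [i|j] [i'|j'] //=.
  - move/eqP; rewrite nth_uniq ?sn // => /eqP/val_inj-> //.
  - by move=> E; case/negP: ws; rewrite -E mem_nth ?sn.
  - by move=> E; case/negP: ws; rewrite E mem_nth ?sn.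
  by rewrite (ord1 j) (ord1 j').
have bij_g : bijective g by apply: inj_card_bij; rewrite // card_open_wheel cardG.
have nth_w (i : 'I_n) : nth a s i != w.
  by apply: contraNneq ws => <-; rewrite mem_nth ?sn.
(* As i < j, position i is not the last, so [rim_path_nbr] applies and a neighbour further along can
   only be at i + 1. *)
have edge_lt (i j : 'I_n) : (i < j)%N -> edge (nth a s i) (nth a s j) = (i.+1 == j).
  move=> ij; apply/idP/eqP => [eij|<-]; last by apply: es; rewrite sn; have := ltn_ord j; lia.
  have jn := ltn_ord j.
  have si : (i.+1 < size s)%N by rewrite sn; lia.
  case: (rim_path_nbr s i (nth a s j) rs si (nth_w j) eij) => [|[_]] /eqP;
    by rewrite nth_uniq ?sn //; lia.
apply: isomorphic_sym; exists g => // -[i|i] [j|j] /=.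
- rewrite /path_rel; case: (ltngtP i j) => ij.
  + by rewrite edge_lt // [j.+1 == i]gtn_eqF ?orbF //; lia.
  + by rewrite edge_sym edge_lt // [i.+1 == j]gtn_eqF //; lia.
  by rewrite ij edge_irrefl orbb gtn_eqF.
- by rewrite edge_sym wU.
- by rewrite wU.
by rewrite (ord1 i) (ord1 j) !edge_irrefl.
Qed.

End Recognition.

(** * The characterization *)

Theorem proposition34 (n : nat) (G : sgraph) (hn : (4 <= n)%N) (hG : (0 < #|G|)%N) :
  isomorphic G (open_wheel n) <->
  [/\ (da G)`_1 = 2%:R * 'X^(n - 1) + (n - 2)%:R * 'X^(n - 2) + 'X,
      (da G)`_n = 3%:R * 'X^(n + 1) + (n - 2)%:R * 'X^(n + 2)
    & (da G)`_(n + 1) = 'X^(n + 3)].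
Proof.
split=> [/isomorphic_da->|[da1 dan _]].
  by split; [exact: da_open_wheel1 | exact: da_open_wheeln | exact: da_open_wheeln1].
move: da1; rewrite coef_da1 => da1.
have cardG : #|G| = n.+1.
  (* At y = 1 each vertex contributes 1, so the order is 2 + (n - 2) + 1. *)
  move: (congr1 (horner^~ 1) da1); rewrite horner_sum.
  rewrite (eq_bigr (fun=> 1)) => [|u _]; last by rewrite !hornerE expr1n.
  rewrite !mulr_natl !hornerE !expr1n sumr_const cardT -cardE.
  rewrite hornerMn hornerXn expr1n [1 + 1](_ : _ = 2%:R) // -!natrD -mulrSr => /eqP.
  by rewrite Num.Theory.eqr_nat => /eqP->; lia.
have cnt (k : nat) : #|[set u : G | n.+1 - deg_in setT u == k]%N|
    = (2 * (k == n - 1) + (n - 2) * (k == n - 2) + (k == 1))%N.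
  move: (congr1 (fun p : {poly int} => p`_k) da1).
  rewrite !mulr_natl !coefD !coefMn !coefXn coefX coef_sum.
  under eq_bigr => u _ do rewrite coefXn cardG eq_sym.
  rewrite -natr_sum -!mulrnA -!natrD => /eqP.
  rewrite Num.Theory.eqr_nat => /eqP.
  rewrite mul2n -addnn [((n - 2) * _)%N]mulnC => <-.
  rewrite -sum1_card big_mkcond.
  by apply: eq_bigr => u _; rewrite inE; case: eqP.
(* The exponent that a vertex contributes has a positive coefficient, so it is n - 1, n - 2 or 1. *)
have deg_val u : deg_in [set: G] u \in [:: 2; 3; n].
  have : (0 < #|[set v : G | n.+1 - deg_in setT v == n.+1 - deg_in setT u]%N|)%N.
    by apply/card_gt0P; exists u; rewrite inE.
  rewrite cnt !inE; have := deg_in_max _ [set: G] u; rewrite cardG; lia.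
(* Since n is at least 4, the exponent 1 differs from n - 1 and n - 2, so exactly one vertex has
   it. *)
have /cards1P[w /setP wE] : #|[set u : G | n.+1 - deg_in setT u == 1]%N| == 1%N.
  by rewrite cnt; lia.
have [a] : exists a, a \in [set u : G | n.+1 - deg_in setT u == n - 1]%N.
  by apply/card_gt0P; rewrite cnt; lia.
rewrite inE => aE.
have deg_w : deg_in [set: G] w = n by have := wE w; rewrite !inE eqxx; lia.
have deg_a : deg_in [set: G] a = 2 by have := deg_val a; rewrite !inE; lia.
apply: (recognize_open_wheel _ _ w a) => //; last by lia.
- move=> u uw.
  have nbr_w : [set v in [set: G] | edge w v] == [set~ w].
    rewrite eqEcard cardsC1 cardG -/(deg_in _ _) deg_w leqnn andbT.
    by apply/subsetP => v; rewrite !inE /=; apply: contraTneq => ->; rewrite edge_irrefl.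
  by move/eqP/setP/(_ u): nbr_w; rewrite !inE uw.
- by apply: contraTneq hn => aw; move: deg_a; rewrite aw deg_w => ->.
- move=> u uw; have := deg_val u; have := wE u; rewrite !inE (negPf uw); lia.
have nE : n = n.-1.+1 by lia.
move: (congr1 (horner^~ 1) dan); rewrite [in X in X -> _]nE coef_da_predn; last by lia.
rewrite horner_sum.
rewrite (eq_bigr (fun v => (connected (induced [set~ v]))%:R)); last first.
  by move=> v _; case: ifP; rewrite ?hornerXn ?expr1n ?horner0.
rewrite !mulr_natl !hornerD !hornerMn !hornerXn !expr1n.
rewrite [1 + (1 + 1)](_ : _ = 3%:R) // -!natrD -natr_sum => /eqP.
rewrite Num.Theory.eqr_nat (bigD1 w) //=; case: (connected _) => // /eqP.
(* If G - w were disconnected, only the n other deletions could contribute, fewer than the required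
   3 + (n - 2). *)
have : (\sum_(v | v != w) connected (induced [set~ v]) <= n)%N.
  rewrite -[leqRHS]/(n.+1.-1) -cardG -(cardC1 w) -sum1_card.
  by apply: leq_sum => v _; case: (connected _).
by lia.
Qed.
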